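(* Let $F$ be a field, $m\ge 1$ an integer, and let $*_\mu$ be a multiplication on the space $\mathfrak C$ of $m\times m\times m$ cubic matrices over $F$, with corresponding algebra of cubic matrices $\mathfrak C_\mu=(\mathfrak C,*_\mu)$. 1. If $\mathfrak C_\mu$ is power-associative, then for every cubic matrix $Q\in\mathfrak C_\mu$ the family $\mathcal M^{[n,p]}=Q^{*_\mu(p-n)}$ (for natural numbers $n<p$) generates a discrete-time flow of algebras (FA) of type $\mu$. 2. If $\mathfrak C_\mu$ has an idempotent, i.e. there exists $\mathcal I\in\mathfrak C_\mu$ such that $\mathcal I*_\mu\mathcal I=\mathcal I$, then the family $\mathcal M^{[s,t]}=\mathcal I$ for all $0\le s<t$ generates an FA of type $\mu$.
   Context: A cubic matrix over a field $F$ is an array $Q=(q_{ijk})_{i,j,k=1}^m$ with entries in $F$; $\mathfrak C$ is the $m^3$-dimensional $F$-vector space of all of them (entrywise operations). A multiplication $*_\mu$ on $\mathfrak C$ is an arbitrary $F$-bilinear map $\mathfrak C\times\mathfrak C\to\mathfrak C$ (equivalently, it is given by structural constants on the basis of cubic unit matrices $E_{ijk}$); $\mathfrak C_\mu=(\mathfrak C,*_\mu)$ is the resulting algebra. An algebra is power-associative if for each element $a$ the subalgebra generated by $a$ is associative, that is, $a^na^k=a^{n+k}$. The powers are $Q^{*_\mu n}=\underbrace{Q*_\mu Q*_\mu\cdots*_\mu Q}_{n\text{ times}}$, $n=1,2,\dots$. A family of cubic matrices $\mathcal M^{[s,t]}=(c^{[s,t]}_{ijk})_{i,j,k=1}^m$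 indexed by real $0\le s<t$ generates an FA (flow of algebras) of type $\mu$ if it satisfies the Kolmogorov-Chapman equation $\mathcal M^{[s,t]}=\mathcal M^{[s,\tau]}*_\mu\mathcal M^{[\tau,t]}$ for all $0\le s<\tau<t$; the FA is then the family of $m$-dimensional algebras $\mathcal A^{[s,t]}$ over $F$ with basis $e_1,\dots,e_m$ and products $e_ie_j=\sum_{k=1}^m c^{[s,t]}_{ijk}e_k$. The FA is called discrete-time if the time parameters run over natural numbers only, i.e. the equation is $\mathcal M^{[n,p]}=\mathcal M^{[n,k]}*_\mu\mathcal M^{[k,p]}$ for all natural numbers $n<k<p$. *)

(* Defs.v *)
From HB Require Import structures.
From mathcomp Require Import all_boot all_order all_algebra.
From mathcomp Require Import reals.

Set Implicit Arguments.
Unset Strict Implicit.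
Unset Printing Implicit Defensive.

Import Order.TTheory GRing.Theory Num.Theory.
Local Open Scope ring_scope.

(* [F^o] is F viewed as a vector space over itself; it gives the space of
   arrays its entrywise vector space structure, of dimension m ^ 3. *)
Definition cubic (F : fieldType) (m : nat) : vectType F :=
  {ffun 'I_m * 'I_m * 'I_m -> F^o}.

Definition entry (F : fieldType) (m : nat) (Q : cubic F m) (i j k : 'I_m) : F :=
  (Q : {ffun 'I_m * 'I_m * 'I_m -> F^o}) (i, j, k).

(* Bilinear over F, but neither associative nor commutative nor unital. *)
Notation multiplication V := {bilinear V -> V -> V}.

Section PowerAssociativity.
Variables (F : fieldType) (V : vectType F) (mu : multiplication V).

Definition is_subalgebra (U : {vspace V}) : Prop :=
  forall x y, x \in U -> y \in U -> mu x y \in U.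

Definition in_generated_subalgebra (a x : V) : Prop :=
  forall U : {vspace V}, is_subalgebra U -> a \in U -> x \in U.

Definition power_associative : Prop :=
  forall a x y z : V,
    in_generated_subalgebra a x -> in_generated_subalgebra a y ->
    in_generated_subalgebra a z ->
    mu (mu x y) z = mu x (mu y z).

(* The n-th power, n >= 1, bracketed to the left: ((a * a) * a) * ...
   For n = 0 this returns a, a value without meaning. *)
Definition power (a : V) (n : nat) : V := iter n.-1 (fun x => mu x a) a.

End PowerAssociativity.

Section FlowOfAlgebras.
Variables (F : fieldType) (m : nat) (mu : multiplication (cubic F m)).

(* [A] is the product of the m-dimensional algebra with basis e_1, ..., e_m
   (the standard basis of 'rV_m) and structural constants [Q]. *)
Definition has_structural_constants
    (A : multiplication 'rV[F]_m) (Q : cubic F m) : Prop :=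
  forall i j : 'I_m,
    A (delta_mx 0 i) (delta_mx 0 j) = \sum_(k < m) entry Q i j k *: delta_mx 0 k.

Definition Kolmogorov_Chapman (R : realType) (M : R -> R -> cubic F m) : Prop :=
  forall s tau t : R, 0 <= s -> s < tau -> tau < t ->
    M s t = mu (M s tau) (M tau t).

(* Values of [M] and [A] outside of 0 <= s < t are irrelevant. *)
Definition generates_FA (R : realType) (M : R -> R -> cubic F m) : Prop :=
  Kolmogorov_Chapman M /\
  exists A : R -> R -> multiplication 'rV[F]_m,
    forall s t : R, 0 <= s -> s < t -> has_structural_constants (A s t) (M s t).

Definition discrete_Kolmogorov_Chapman (M : nat -> nat -> cubic F m) : Prop :=
  forall n k p : nat, (n < k)%N -> (k < p)%N -> M n p = mu (M n k) (M k p).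

Definition generates_discrete_FA (M : nat -> nat -> cubic F m) : Prop :=
  discrete_Kolmogorov_Chapman M /\
  exists A : nat -> nat -> multiplication 'rV[F]_m,
    forall n p : nat, (n < p)%N -> has_structural_constants (A n p) (M n p).

End FlowOfAlgebras.

(* Main.v *)
Require Import Defs.
From HB Require Import structures.
From mathcomp Require Import all_boot all_order all_algebra.
From mathcomp Require Import reals.

Set Implicit Arguments.
Unset Strict Implicit.
Unset Printing Implicit Defensive.

Import Order.TTheory GRing.Theory Num.Theory.
Local Open Scope ring_scope.

(** Associativity on the subalgebra generated by Q gives the power law Q^a * Q^b = Q^(a+b) for a, b
    >= 1 ([power_addn]), and the Kolmogorov-Chapman equation for powers is this law at (k - n) + (p
    - k) = p - n. For a constant family the equation is the idempotent law itself. The algebras of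
    the flow exist because any cubic matrix is the array of structural constants of some bilinear
    product ([structural_mul]). *)

Section Powers.
Variables (F : fieldType) (V : vectType F) (mu : multiplication V).

Lemma powerS (a : V) (n : nat) : power mu a n.+2 = mu (power mu a n.+1) a.
Proof. by []. Qed.

Lemma in_generated_subalgebra_power (a : V) (n : nat) :
  in_generated_subalgebra mu a (power mu a n.+1).
Proof.
move=> U subU aU; elim: n => [//|n IHn].
by rewrite powerS; apply: subU.
Qed.

(** Induction on the right exponent, moving one factor at a time: x * (y * a) = (x * y) * a for
    powers x, y of a. *)
Lemma power_addn (a : V) (n k : nat) :
  power_associative mu ->
  mu (power mu a n.+1) (power mu a k.+1) = power mu a (n.+1 + k.+1).
Proof.
move=> paV; elim: k => [|k IHk]; first by rewrite addn1.
(* Reassociation is legitimate because the two powers and [a] itself all lie in the subalgebra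
   generated by [a]. *)
rewrite powerS -(paV a); try exact: in_generated_subalgebra_power.
  by rewrite IHk !addnS -powerS.
by move=> U _ aU.
Qed.

End Powers.

Section StructuralConstants.
Variables (F : fieldType) (m : nat) (Q : cubic F m).

(* The k-th coordinate of the product of two row vectors u and v is
   u Q_k v^T, where Q_k is the slice (q_ijk)_ij. *)
Definition structural_mul (u v : 'rV[F]_m) : 'rV[F]_m :=
  \row_k (u *m (\matrix_(i, j) entry Q i j k) *m v^T) 0 0.

Lemma structural_mul_is_bilinear : bilinear_for *:%R *:%R structural_mul.
Proof.
split=> [v | u] a x y; apply/rowP=> k.
  rewrite [LHS]mxE [RHS]mxE [in RHS]mxE 2![structural_mul _ _ _ _]mxE.
  by rewrite !mulmxDl -!scalemxAl 2!mxE.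
rewrite [LHS]mxE [RHS]mxE [in RHS]mxE 2![structural_mul _ _ _ _]mxE.
by rewrite linearP /= mulmxDr -scalemxAr 2!mxE.
Qed.

HB.instance Definition _ :=
  bilinear_isBilinear.Build F 'rV[F]_m 'rV[F]_m 'rV[F]_m *:%R *:%R
    structural_mul structural_mul_is_bilinear.

Lemma structural_mul_constants : has_structural_constants structural_mul Q.
Proof.
move=> i j /=; rewrite [LHS]row_sum_delta; apply: eq_bigr => k _.
(* Multiplying the slice Q_k by e_i on the left and e_j^T on the right extracts its (i, j) entry. *)
by rewrite mxE -rowE trmx_delta -colE !mxE.
Qed.

End StructuralConstants.

Theorem proposition1 (R : realType) (F : fieldType) (m : nat) (hm : (1 <= m)%N)
    (mu : multiplication (cubic F m)) :
  (power_associative mu ->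
   forall Q : cubic F m,
     generates_discrete_FA mu (fun n p : nat => power mu Q (p - n)%N))
  /\
  (forall I : cubic F m, mu I I = I ->
     generates_FA mu (fun _ _ : R => I)).
Proof.
split=> [pa_mu Q | I mu_I]; split.
- move=> n k p lt_nk lt_kp.
  (* Both exponents are positive, so they can be written as successors, the form [power_addn]
     expects; the meaningless zeroth power never occurs. *)
  have /prednK <- : (0 < k - n)%N by rewrite subn_gt0.
  have /prednK <- : (0 < p - k)%N by rewrite subn_gt0.
  rewrite power_addn // !prednK ?subn_gt0 //.
  by rewrite addnC addnBA ?subnK // ltnW.
- exists (fun n p => structural_mul (power mu Q (p - n)%N)) => n p _.
  exact: structural_mul_constants.
- by move=> s tau t _ _ _; rewrite mu_I.
- exists (fun _ _ => structural_mul I) => s t _ _.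
  exact: structural_mul_constants.
Qed.
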